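(* Let $\Gamma$ be a lattice in $SL(2,\mathbb{R})$. Then the upper bound $$ \mu_\Gamma(\mathbf{x})\le\frac12 $$ holds for every point $\mathbf{x}\in\mathbb{R}^2$ such that the orbit $\Gamma\mathbf{x}$ is dense in $\mathbb{R}^2$.
   Context: A lattice $\Gamma$ in $SL(2,\mathbb{R})$ is a discrete subgroup such that the quotient $\Gamma\backslash SL(2,\mathbb{R})$ has finite Haar measure. $\mathbb{R}^2$ is viewed as a space of column vectors on which $\Gamma$ acts by left multiplication. $\mathbb{R}^2$ is equipped with the supremum norm $|\cdot|$, and for a matrix $\gamma\in\Gamma$, $|\gamma|$ denotes the maximum of the absolute values of its entries. For $\mathbf{x},\mathbf{y}\in\mathbb{R}^2$, $\mu_\Gamma(\mathbf{x},\mathbf{y})$ denotes the supremum (possibly infinite) of the real exponents $\mu$ such that the inequality $|\gamma\mathbf{x}-\mathbf{y}|\le|\gamma|^{-\mu}$ has infinitely many solutions $\gamma\in\Gamma$. For fixed $\mathbf{x}$, the function $\mathbf{y}\mapsto\mu_\Gamma(\mathbf{x},\mathbf{y})$ is $\Gamma$-invariant, hence, by ergodicity of the action of $\Gamma$ on $\mathbb{R}^2$ (with respect to Lebesgue measure), it is constant for Lebesgue-almost every $\mathbf{y}\in\mathbb{R}^2$. The generic density exponent $\mu_\Gamma(\mathbf{x})$ is defined to be this almost-everywhere constant value. *)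

(* Defs.v *)
(* MathComp / MathComp-Analysis, over an arbitrary R : realType.  Matrices and
   column vectors carry the library's topology and norm; the latter is mx_norm,
   the maximum of the absolute values of the entries. *)
From HB Require Import structures.
From mathcomp Require Import all_boot all_order all_algebra.
From mathcomp Require Import all_classical all_reals all_analysis.
From mathcomp Require Import ess_sup_inf.

Set Implicit Arguments.
Unset Strict Implicit.
Unset Printing Implicit Defensive.

Import Order.TTheory GRing.Theory Num.Theory.
Import numFieldNormedType.Exports.

Local Open Scope classical_set_scope.
Local Open Scope ring_scope.

Definition SL2 (R : realType) : set 'M[R]_2 := [set g | \det g = 1].

Definition subgroup_SL2 (R : realType) (Gamma : set 'M[R]_2) : Prop :=
  [/\ Gamma `<=` @SL2 R,
      Gamma 1%:M,
      forall g h, Gamma g -> Gamma h -> Gamma (g *m h)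
    & forall g, Gamma g -> Gamma (invmx g)].

Definition borelM2 (R : realType) := g_sigma_algebraType (@open 'M[R]_2).

(* SL2 is closed in 'M[R]_2, so the Borel subsets of SL2 are the Borel subsets
   of 'M[R]_2 contained in it; only the values of m on those matter. *)
Definition haar_measure_SL2 (R : realType)
    (m : {measure set (borelM2 R) -> \bar R}) : Prop :=
  [/\ (0 < m (@SL2 R))%E,
      forall K : set 'M[R]_2, K `<=` @SL2 R -> compact K -> (m K < +oo)%E
    & forall (g : 'M[R]_2) (A : set (borelM2 R)),
        SL2 g -> measurable A -> A `<=` @SL2 R ->
        m [set g *m a | a in (A : set 'M[R]_2)] = m A].

Definition fundamental_domain (R : realType) (Gamma : set 'M[R]_2)
    (F : set (borelM2 R)) : Prop :=
  [/\ measurable F,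
      F `<=` @SL2 R
    & forall g : 'M[R]_2, SL2 g ->
        exists! gamma : 'M[R]_2, Gamma gamma /\ F (gamma *m g)].

(* The Haar measure of the quotient of SL2 by the left action of a discrete
   Gamma is that of any Borel fundamental domain. *)
Definition lattice_SL2 (R : realType) (Gamma : set 'M[R]_2) : Prop :=
  [/\ subgroup_SL2 Gamma,
      Gamma `<=` isolated Gamma
    & exists (m : {measure set (borelM2 R) -> \bar R}) (F : set (borelM2 R)),
        [/\ haar_measure_SL2 m, fundamental_domain Gamma F & (m F < +oo)%E]].

Definition orbit_col (R : realType) (Gamma : set 'M[R]_2) (x : 'cV[R]_2) :
    set 'cV[R]_2 :=
  [set gamma *m x | gamma in Gamma].

Definition density_exponent (R : realType) (Gamma : set 'M[R]_2)
    (x y : 'cV[R]_2) : \bar R :=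
  ereal_sup [set mu%:E | mu in [set mu : R |
    infinite_set [set gamma : 'M[R]_2 |
      Gamma gamma /\ `|gamma *m x - y| <= `|gamma| `^ (- mu)]]].

Definition lebesgue2 (R : realType) :
    {measure set (measurableTypeR R * measurableTypeR R) -> \bar R} :=
  (@lebesgue_measure R \x @lebesgue_measure R)%E.

Definition col_of_pair (R : realType) (p : R * R) : 'cV[R]_2 :=
  \col_(i < 2) if i == ord0 then p.1 else p.2.

Definition ae_density_exponent (R : realType) (Gamma : set 'M[R]_2)
    (x : 'cV[R]_2) (c : \bar R) : Prop :=
  {ae @lebesgue2 R, forall p, density_exponent Gamma x (col_of_pair p) = c}.

(* The value taken by density_exponent Gamma x almost everywhere.  For a lattice
   such a value exists, by ergodicity of the action of Gamma on the plane, and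
   it is unique since the plane has positive measure.  xget needs a default for
   the case where the function is not almost everywhere constant: the essential
   supremum is used, so that even then an upper bound on
   generic_density_exponent bounds density_exponent almost everywhere. *)
Definition generic_density_exponent (R : realType) (Gamma : set 'M[R]_2)
    (x : 'cV[R]_2) : \bar R :=
  xget (ess_sup (@lebesgue2 R)
         (fun p => density_exponent Gamma x (col_of_pair p)))
       (ae_density_exponent Gamma x).

(* Main.v *)
Require Import Defs.
From HB Require Import structures.
From mathcomp Require Import all_boot all_order all_algebra.
From mathcomp Require Import all_classical all_reals all_analysis.
From mathcomp Require Import ess_sup_inf ring lra.

Set Implicit Arguments.
Unset Strict Implicit.
Unset Printing Implicit Defensive.

Import Order.TTheory GRing.Theory Num.Theory.
Import numFieldNormedType.Exports.

Local Open Scope classical_set_scope.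
Local Open Scope ring_scope.

(** The theorem is the convergence half of the Borel-Cantelli lemma, fed with a
    count of orbit points that comes from the discreteness of Gamma.

    Fix x <> 0 and an annulus 1/B <= |v| <= B of the plane.  The claim behind
    everything is that at most O(n) elements gamma of Gamma have norm at most n
    and move x into the annulus (discrete_orbit_count).  Choose h in SL(2) with
    first column x and write gamma h = P(v) n(t), where v = gamma x, P(v) is a
    matrix of determinant one depending only on v, and n(t) is upper
    triangular unipotent.  The vector v stays in a bounded set and t = O(n).  If
    gamma and gamma' have coordinates (v, t) that are close, then
      gamma' gamma^-1 = P(v') n(t' - t) P(v)^-1
    is close to the identity (iwasawa_close), hence equal to it by
    discreteness.  So a grid of fixed mesh, which has O(n) cells, has at most
    one gamma in each cell.

    Given mu > 1/2, the points p of the plane with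
    |gamma x - p| <= |gamma|^-mu for some gamma with |gamma| in
    [2^k, 2^(k+1)] and gamma x in the annulus lie in O(2^k) squares of area
    O(2^(-2 mu k)).  These areas have a finite sum over k, and so almost no p
    belongs to infinitely many of these sets (approximable_null).  A point p
    other than the origin at which the exponent exceeds 1/2 is approximated in
    this way for some annulus and some mu > 1/2, both of which can be taken in a
    countable family (density_exponent_gt_half).  Hence the exponent is at
    most 1/2 almost everywhere, and so is its generic value. *)

(** * Two by two matrices and the supremum norm *)

Lemma ord2_cases (i : 'I_2) : i = 0 \/ i = 1.
Proof.
by case: i => -[|[|//]] ?; [left | right]; exact: val_inj.
Qed.

Lemma mulmx2E (R : comNzRingType) m n (A : 'M[R]_(m, 2)) (B : 'M[R]_(2, n)) i j :
  (A *m B) i j = A i 0 * B 0 j + A i 1 * B 1 j.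
Proof.
rewrite mxE !big_ord_recl big_ord0 addr0.
by congr (_ + A i _ * B _ j); exact: val_inj.
Qed.

Lemma det_mx2E (R : comNzRingType) (A : 'M[R]_2) :
  \det A = A 0 0 * A 1 1 - A 0 1 * A 1 0.
Proof.
rewrite (expand_det_row _ 0) !big_ord_recl big_ord0 addr0.
have -> : lift (0 : 'I_2) (0 : 'I_1) = 1 by exact: val_inj.
rewrite /cofactor !det_mx11 !mxE /= expr0 expr1 mul1r mulN1r mulrN.
by congr (_ * A _ _ - _ * A _ _); exact: val_inj.
Qed.

Section mx_norm_entries.
Context {R : realType}.

Lemma mx_entry_le_norm m n (A : 'M[R]_(m, n)) i j : `|A i j| <= `|A|.
Proof.
by rewrite [leRHS]/Num.norm /= mx_normrE; apply/bigmax_geP; right; exists (i, j).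
Qed.

Lemma mx_norm_le m n (A : 'M[R]_(m, n)) c :
  0 <= c -> (forall i j, `|A i j| <= c) -> `|A| <= c.
Proof.
move=> c0 Ac; rewrite [leLHS]/Num.norm /= mx_normrE.
by apply/bigmax_leP; split=> // -[i j] _; exact: Ac.
Qed.

Lemma mulmx2_norm_le m n (A : 'M[R]_(m, 2)) (B : 'M[R]_(2, n)) :
  `|A *m B| <= 2 * `|A| * `|B|.
Proof.
apply: mx_norm_le => [|i j]; first by rewrite !mulr_ge0.
rewrite mulmx2E (le_trans (ler_normD _ _))// !normrM -mulrA mulr_natl mulr2n.
by apply: lerD; apply: ler_pM => //; exact: mx_entry_le_norm.
Qed.

Lemma det1_inv_norm_le (A : 'M[R]_2) : \det A = 1 -> `|invmx A| <= `|A|.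
Proof.
move=> detA; apply: mx_norm_le => // i j.
have uA : A \in unitmx by rewrite unitmxE detA unitr1.
rewrite /invmx uA detA invr1 scale1r mxE /cofactor normrM normrX normrN1.
by rewrite expr1n mul1r det_mx11 !mxE; exact: mx_entry_le_norm.
Qed.

(** The norm of a matrix of determinant one and that of its inverse agree, so
    such a matrix cannot contract a vector more than it can expand one. *)
Lemma det1_mul_col_norm_ge (A : 'M[R]_2) (x : 'cV[R]_2) :
  \det A = 1 -> `|x| <= 2 * `|A| * `|A *m x|.
Proof.
move=> detA; have uA : A \in unitmx by rewrite unitmxE detA unitr1.
rewrite -[in leLHS](mulKmx uA x) (le_trans (mulmx2_norm_le _ _))//.
by rewrite ler_wpM2r// ler_wpM2l// det1_inv_norm_le.
Qed.

End mx_norm_entries.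

(** * Iwasawa coordinates on SL(2) *)

Section iwasawa.
Context {R : realType}.
Implicit Types g u : 'M[R]_2.

Definition col0_sqr g := g 0 0 ^+ 2 + g 1 0 ^+ 2.

(** With g of first column v and determinant one, v and the orthogonal vector
    (- v1, v0) / (v0 ^ 2 + v1 ^ 2) form a matrix P(v) of determinant one, and
    g = P(v) n(t) where n(t) is the unipotent upper triangular matrix of corner
    t.  The coordinates are the entries of P(v) up to sign, followed by t. *)
Definition iwasawa g : R * R * R * R * R :=
  let a := g 0 0 / col0_sqr g in let b := g 1 0 / col0_sqr g in
  (g 0 0, g 1 0, a, b, a * g 0 1 + b * g 1 1).

Lemma det1_col0_sqr_gt0 g : \det g = 1 -> 0 < col0_sqr g.
Proof.
rewrite det_mx2E /col0_sqr => dg.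
rewrite lt_neqAle addr_ge0 ?sqr_ge0// andbT eq_sym paddr_eq0 ?sqr_ge0//.
rewrite !sqrf_eq0; apply/negP => /andP[/eqP g0 /eqP g1].
by move: dg; rewrite g0 g1 mul0r mulr0 subr0 => /esym/eqP; rewrite oner_eq0.
Qed.

Definition coord_le (z : R * R * R * R * R) (B T : R) : Prop :=
  let: (v0, v1, a, b, t) := z in
  [/\ `|v0| <= B, `|v1| <= B, `|a| <= B, `|b| <= B & `|t| <= T].

Definition coord_close (e : R) (z w : R * R * R * R * R) : Prop :=
  let: (v0, v1, a, b, t) := z in let: (v0', v1', a', b', t') := w in
  [/\ `|v0' - v0| <= e, `|v1' - v1| <= e, `|a' - a| <= e,
      `|b' - b| <= e & `|t' - t| <= e].

Lemma three_terms_le (x y z p q r s e B : R) :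
  `|x| <= e -> `|y| <= B -> `|z| <= e -> `|p| <= B ->
  `|q| <= e -> `|r| <= B -> `|s| <= B ->
  `|x * y + z * p + q * r * s| <= e * B + e * B + e * B * B.
Proof.
move=> xe yB ze pB qe rB sB; rewrite (le_trans (ler_normD _ _))// lerD//.
  by rewrite (le_trans (ler_normD _ _))// lerD// normrM ler_pM.
by rewrite !normrM ler_pM// ler_pM.
Qed.

(** When u = g' g^-1, with g = P n(t) and g' = P' n(t'), one has
    u = 1 + (P' - P) P^-1 + P' (n(t' - t) - 1) P^-1.  The large coordinates t
    and t' enter only through their difference: this is why close coordinates
    force u to be near the identity, even where g itself is large. *)
Lemma iwasawa_close g g' u (B T T' e : R) : \det g = 1 -> \det g' = 1 ->
  u *m g = g' -> coord_le (iwasawa g) B T -> coord_le (iwasawa g') B T' ->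
  coord_close e (iwasawa g) (iwasawa g') ->
  `|u - 1%:M| <= e * B + e * B + e * B * B.
Proof.
move=> dg dg' ug.
have D0 := det1_col0_sqr_gt0 dg; have D0' := det1_col0_sqr_gt0 dg'.
have /= [u00 u01 u10 u11] : [/\
  u 0 0 = g' 0 0 * g 1 1 - g' 0 1 * g 1 0,
  u 0 1 = g' 0 1 * g 0 0 - g' 0 0 * g 0 1,
  u 1 0 = g' 1 0 * g 1 1 - g' 1 1 * g 1 0 &
  u 1 1 = g' 1 1 * g 0 0 - g' 1 0 * g 0 1].
  rewrite -ug !mulmx2E; move: dg; rewrite det_mx2E => dg.
  by split; rewrite -[LHS]mulr1 -dg; ring.
move: dg dg' D0 D0'; rewrite !det_mx2E /iwasawa /col0_sqr /coord_le /coord_close.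
move: (g 0 0) (g 0 1) (g 1 0) (g 1 1) u00 u01 u10 u11 => v0 w0 v1 w1.
move: (g' 0 0) (g' 0 1) (g' 1 0) (g' 1 1) => v0' w0' v1' w1' u00 u01 u10 u11.
move=> dg dg' D0 D0'.
set a := v0 / _; set b := v1 / _; set a' := v0' / _; set b' := v1' / _.
set t := a * w0 + _; set t' := a' * w0' + _.
have Dn : v0 ^+ 2 + v1 ^+ 2 != 0 by rewrite gt_eqF.
have Dn' : v0' ^+ 2 + v1' ^+ 2 != 0 by rewrite gt_eqF.
have vv : a * v0 + b * v1 = 1 by rewrite /a /b; field.
have vo : a * v1 = b * v0 by rewrite /a /b; field.
have vv' : a' * v0' + b' * v1' = 1 by rewrite /a' /b'; field.
have vo' : a' * v1' = b' * v0' by rewrite /a' /b'; field.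
have ew0 : w0 = t * v0 - b.
  by rewrite -[LHS]mulr1 -vv -[X in _ = _ - X]mulr1 -dg /t; ring.
have ew1 : w1 = t * v1 + a.
  by rewrite -[LHS]mulr1 -vv -[X in _ = _ + X]mulr1 -dg /t; ring.
have ew0' : w0' = t' * v0' - b'.
  by rewrite -[LHS]mulr1 -vv' -[X in _ = _ - X]mulr1 -dg' /t'; ring.
have ew1' : w1' = t' * v1' + a'.
  by rewrite -[LHS]mulr1 -vv' -[X in _ = _ + X]mulr1 -dg' /t'; ring.
move=> [v0B v1B aB bB _] [v0B' v1B' _ _ _] [e0 e1 ea eb et].
have Nv0B : `|- v0'| <= B by rewrite normrN.
have Nv1B : `|- v1'| <= B by rewrite normrN.
have NbB : `|- v1| <= B by rewrite normrN.
have NvB : `|- v0| <= B by rewrite normrN.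
apply: mx_norm_le => [|i j].
  by rewrite (le_trans _ (three_terms_le e0 aB e0 aB e0 aB aB)).
rewrite [X in `|X|]mxE [X in _ + X]mxE [X in _ - X]mxE.
case: (ord2_cases i) => ->; case: (ord2_cases j) => -> /=.
- rewrite u00 mulr1n -vv ew0' ew1.
  have -> : v0' * (t * v1 + a) - (t' * v0' - b') * v1 - (a * v0 + b * v1) =
    (v0' - v0) * a + (b' - b) * v1 + (t' - t) * - v0' * v1 by ring.
  exact: three_terms_le.
- rewrite u01 mulr0n subr0 ew0' ew0.
  have -> : (t' * v0' - b') * v0 - v0' * (t * v0 - b) =
    (v0' - v0) * b + (b' - b) * - v0 + (t' - t) * v0' * v0 by ring.
  exact: three_terms_le.
- rewrite u10 mulr0n subr0 ew1' ew1.
  have -> : v1' * (t * v1 + a) - (t' * v1' + a') * v1 =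
    (v1' - v1) * a + (a' - a) * - v1 + (t' - t) * - v1' * v1 by ring.
  exact: three_terms_le.
- rewrite u11 mulr1n -vv ew1' ew0.
  have -> : (t' * v1' + a') * v0 - v1' * (t * v0 - b) - (a * v0 + b * v1) =
    (v1' - v1) * b + (a' - a) * v0 + (t' - t) * v1' * v0 by ring.
  exact: three_terms_le.
Qed.

End iwasawa.

Section coordinates_bound.
Context {R : realType}.

Lemma SL2_first_col (x : 'cV[R]_2) : x != 0 ->
  exists2 h : 'M[R]_2, \det h = 1 & col 0 h = x.
Proof.
move=> x0; pose D := x 0 0 ^+ 2 + x 1 0 ^+ 2.
have D0 : D != 0.
  apply: contra x0; rewrite paddr_eq0 ?sqr_ge0// !sqrf_eq0 => /andP[/eqP e0 /eqP e1].
  by apply/eqP/matrixP => i j; rewrite mxE ord1; case: (ord2_cases i) => ->.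
exists (\matrix_(i, j) if j == 0 then x i 0
                       else if i == 0 then - x 1 0 / D else x 0 0 / D).
  by rewrite det_mx2E !mxE /=; rewrite /D in D0 *; field.
by apply/matrixP => i j; rewrite !mxE /= ord1.
Qed.

(** Some entry of v, the first column, has absolute value at least 1/B; calling
    it v_k, every entry w of v satisfies |w| <= B |w| |v_k| <= B (v0^2 + v1^2),
    which bounds the third and fourth coordinates. *)
Lemma iwasawa_bound (g : 'M[R]_2) (B M : R) : \det g = 1 -> 0 < B ->
  B^-1 <= `|col 0 g| -> `|col 0 g| <= B -> `|g| <= M ->
  coord_le (iwasawa g) B (2 * B * M).
Proof.
move=> dg B0 Bv vB gM.
have gB i : `|g i 0| <= B.
  by rewrite (le_trans _ vB)//; have := mx_entry_le_norm (col 0 g) i 0; rewrite mxE.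
have D0 := det1_col0_sqr_gt0 dg.
have [k Bk] : exists k, 1 <= B * `|g k 0|.
  have v0 : `|col 0 g| != 0 by rewrite gt_eqF// (lt_le_trans _ Bv)// invr_gt0.
  have [[k l] /= vk] := mx_norm_neq0 v0.
  exists k; move: Bv; rewrite [leRHS]vk mxE => /(ler_wpM2l (ltW B0)).
  by rewrite divff ?gt_eqF.
have ikD i : `|g i 0| * `|g k 0| <= col0_sqr g.
  have [s0 s1] : `|g 0 0| ^+ 2 = g 0 0 ^+ 2 /\ `|g 1 0| ^+ 2 = g 1 0 ^+ 2.
    by rewrite !real_normK ?num_real.
  rewrite /col0_sqr -s0 -s1.
  have := normr_ge0 (g 0 0); have := normr_ge0 (g 1 0).
  by case: (ord2_cases i) => ->; case: (ord2_cases k) => ->; nra.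
have qB i : `|g i 0 / col0_sqr g| <= B.
  rewrite normrM normfV (gtr0_norm D0) ler_pdivrMr//.
  rewrite (le_trans _ (ler_wpM2l (ltW B0) (ikD i)))// mulrCA.
  by rewrite ler_peMr.
split=> //=; rewrite (le_trans (ler_normD _ _))//.
have -> : 2 * B * M = B * M + B * M by ring.
by rewrite lerD// normrM ler_pM// (le_trans (mx_entry_le_norm g _ _)).
Qed.

End coordinates_bound.

(** * Counting the points of a discrete group *)

Lemma injective_on_cover (T : choiceType) (I : finType) (A : set T) (f : T -> I) :
  (forall a b, A a -> A b -> f a = f b -> a = b) ->
  exists2 s : seq T, (size s <= #|I|)%N & forall a, A a -> a \in s.
Proof.
move=> finj; have [->|/set0P[a0 _]] := eqVneq A set0; first by exists [::].
exists [seq xget a0 [set a | A a /\ f a = i] | i <- enum I].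
  by rewrite size_map cardE.
move=> a Aa; apply/mapP; exists (f a); first by rewrite mem_enum.
by case: xgetP => [b _ /= [Ab fab]|/(_ a)/=]; [exact: finj|case].
Qed.

Section counting.
Context {R : realType}.

(** For 2 B <= e N the cells of length e that meet [-B, B] have indices at most N,
    so that inord loses nothing on this interval. *)
Definition cell (e B : R) N (z : R) : 'I_N.+1 := inord (Num.truncn ((z + B) / e)).

Lemma cell_close e B N z z' : 0 < e -> 2 * B <= e * N%:R ->
  `|z| <= B -> `|z'| <= B -> cell e B N z = cell e B N z' -> `|z' - z| <= e.
Proof.
move=> e0 BN zB zB'.
have itv y : `|y| <= B ->
    let k := Num.truncn ((y + B) / e) in
    [/\ e * k%:R <= y + B, y + B < e * k%:R + e & (k < N.+1)%N].
  rewrite ler_norml => /andP[yl yr] /=; set k := Num.truncn _.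
  have y0 : 0 <= (y + B) / e by rewrite divr_ge0 ?(ltW e0)//; lra.
  have /andP[k1 k2] := truncn_itv y0.
  have k1' : e * k%:R <= y + B by rewrite mulrC -ler_pdivlMr.
  split=> //.
    by move: k2; rewrite ltr_pdivrMr// mulrC -natr1 mulrDr mulr1.
  by rewrite ltnS -(ler_nat R) -(ler_pM2l e0) (le_trans k1')//; lra.
have /= [l r k] := itv _ zB; have /= [l' r' k'] := itv _ zB'.
move=> /(congr1 val); rewrite /cell /= !inordK// => kk; move: l' r'; rewrite -kk => l' r'.
by rewrite ler_norml; apply/andP; split; lra.
Qed.

(** The bound is linear in n because the coordinates of gamma h, where h sends
    the first basis vector to x, stay in a box of which four sides are bounded
    and the fifth grows linearly with |gamma|, while a grid cell of small enough
    mesh contains the coordinates of at most one element of a discrete group. *)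
Lemma discrete_orbit_count (Gamma : set 'M[R]_2) (x : 'cV[R]_2) (B : R) :
  subgroup_SL2 Gamma -> Gamma `<=` isolated Gamma -> x != 0 -> 0 < B ->
  exists C : nat, forall n : nat, (0 < n)%N ->
    exists2 s : seq 'M[R]_2, (size s <= C * n)%N &
      forall gamma, Gamma gamma -> `|gamma| <= n%:R ->
        B^-1 <= `|gamma *m x| -> `|gamma *m x| <= B -> gamma \in s.
Proof.
move=> [GSL G1 GM GV] Gisol x0 B0.
have [h dh hx] := SL2_first_col x0.
have [d d0 Gd] : exists2 d : R, 0 < d &
    forall u, Gamma u -> `|u - 1%:M| < d -> u = 1%:M.
  have [_ [V /nbhs_ballP[d /= d0 dV] VG]] := Gisol _ G1.
  exists d => // u Gu ud; suff : [set 1%:M] u by [].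
  rewrite -VG; split=> //; apply: dV.
  by rewrite mx_norm_ball /ball_ /= distrC.
pose S := B + B + B * B; pose e := d / (2 * S).
have S0 : 0 < S by rewrite !addr_gt0// mulr_gt0.
have e0 : 0 < e by rewrite divr_gt0// mulr_gt0.
have eSd : e * B + e * B + e * B * B < d.
  (* The mesh is half of the largest one allowed, to get a strict inequality. *)
  have -> : e * B + e * B + e * B * B = d / 2.
    by rewrite /e /S in S0 *; field; rewrite gt_eqF.
  by rewrite ltr_pdivrMr// mulr2n mulrDr mulr1 ltrDl.
have cover b : exists N : nat, b <= e * N%:R.
  exists (Num.truncn (b / e)).+1; rewrite mulrC -ler_pdivrMr//.
  by rewrite ltW// truncnS_gt.
pose T := 2 * B * (2 * `|h|).
have [N BN] := cover (2 * B); have [K TK] := cover (2 * T).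
exists (N.+1 ^ 4 * K.+1)%N => n n0.
pose f (gamma : 'M[R]_2) := let: (v0, v1, a, b, t) := iwasawa (gamma *m h) in
  (cell e B N v0, cell e B N v1, cell e B N a, cell e B N b,
   cell e (T * n%:R) (K * n) t).
have [|s sN sA] := @injective_on_cover _ _ [set gamma | [/\ Gamma gamma,
   `|gamma| <= n%:R, B^-1 <= `|gamma *m x| & `|gamma *m x| <= B]] f.
- move=> g g' [Gg gn gB Bg] [Gg' gn' gB' Bg'] fgg'.
  have colh k : col 0 (k *m h) = k *m x by rewrite -hx !colE mulmxA.
  have dgh k : Gamma k -> \det (k *m h) = 1.
    by move=> /GSL kSL; rewrite det_mulmx dh mulr1.
  have bnd k : Gamma k -> `|k| <= n%:R -> B^-1 <= `|k *m x| -> `|k *m x| <= B ->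
      coord_le (iwasawa (k *m h)) B (T * n%:R).
    move=> Gk kn kB Bk.
    have -> : T * n%:R = 2 * B * (2 * n%:R * `|h|) by rewrite /T; ring.
    apply: iwasawa_bound; rewrite ?colh//; first exact: dgh.
    by rewrite (le_trans (mulmx2_norm_le _ _))// ler_wpM2r// ler_wpM2l.
  have bg := bnd _ Gg gn gB Bg; have bg' := bnd _ Gg' gn' gB' Bg'.
  have ug : g \in unitmx by rewrite unitmxE (GSL _ Gg) unitr1.
  have uh : h \in unitmx by rewrite unitmxE dh unitr1.
  have ugh : (g' *m invmx g) *m (g *m h) = g' *m h.
    by rewrite mulmxA mulmxKV.
  have cl : coord_close e (iwasawa (g *m h)) (iwasawa (g' *m h)).
    move: fgg' bg bg'; rewrite /f.
    case: (iwasawa (g *m h)) => [[[[v0 v1] a] b] t].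
    case: (iwasawa (g' *m h)) => [[[[v0' v1'] a'] b'] t'].
    move=> [c0 c1 ca cb ct] [l0 l1 la lb lt] [l0' l1' la' lb' lt'].
    have TKn : 2 * (T * n%:R) <= e * (K * n)%:R.
      by rewrite natrM [leLHS]mulrA [leRHS]mulrA ler_wpM2r.
    by split; [exact: (cell_close e0 BN)..|exact: (cell_close e0 TKn)].
  have u1 : g' *m invmx g = 1%:M.
    apply: Gd; first by apply: GM => //; exact: GV.
    exact: le_lt_trans (iwasawa_close (dgh _ Gg) (dgh _ Gg') ugh bg bg' cl) eSd.
  by rewrite -[g']mulmx1 -(mulVmx ug) mulmxA u1 mul1mx.
exists s => [|gamma Gg gn gB Bg]; last exact: sA.
rewrite (leq_trans sN)// !card_prod !card_ord -[leqRHS]mulnA leq_mul//.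
  by rewrite !expnS expn0 muln1 !mulnA.
by rewrite mulSn -addn1 addnC leq_add.
Qed.

(** A matrix of norm at most m in SL(2) changes the length of x by a factor
    at most 2 m either way: one annulus contains the images of x under all of
    them, and the count in this annulus applies. *)
Lemma discrete_finite_ball (Gamma : set 'M[R]_2) (x : 'cV[R]_2) (n : nat) :
  subgroup_SL2 Gamma -> Gamma `<=` isolated Gamma -> x != 0 ->
  finite_set [set gamma | Gamma gamma /\ `|gamma| <= n%:R].
Proof.
move=> Ggrp Gisol x0; have nx : 0 < `|x| by rewrite normr_gt0.
pose m : R := n.+1%:R; have m0 : 0 < m by rewrite ltr0n.
pose B := 2 * m * `|x| + 2 * m / `|x|.
have Bx0 : 0 < 2 * m * `|x| by rewrite !mulr_gt0.
have By0 : 0 < 2 * m / `|x| by rewrite !mulr_gt0// invr_gt0.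
have [C /(_ n.+1 isT)[s _ sG]] := discrete_orbit_count Ggrp Gisol x0 (addr_gt0 Bx0 By0).
apply: (sub_finite_set _ (finite_seq s)) => gamma /= [Gg gn].
have gm : `|gamma| <= m by rewrite (le_trans gn)// ler_nat.
have [GSL _ _ _] := Ggrp.
apply: sG => //.
- have xg : `|x| <= 2 * m * `|gamma *m x|.
    rewrite (le_trans (det1_mul_col_norm_ge x (GSL _ Gg)))//.
    by rewrite ler_wpM2r// ler_wpM2l.
  rewrite (@le_trans _ _ (2 * m / `|x|)^-1)//.
    by rewrite lef_pV2 ?posrE ?addr_gt0// lerDr ltW.
  by rewrite invf_div ler_pdivrMr ?mulr_gt0// mulrC.
- rewrite (@le_trans _ _ (2 * m * `|x|))//; last by rewrite lerDl ltW.
  by rewrite (le_trans (mulmx2_norm_le _ _))// ler_wpM2r// ler_wpM2l.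
Qed.

End counting.

(** * The Borel-Cantelli argument *)

Section borel_cantelli_squares.
Context {R : realType}.

Definition square (c : 'cV[R]_2) (r : R) : set (R * R) :=
  [set p | `|c - col_of_pair p| <= r].

Lemma squareE c r : 0 <= r ->
  square c r = `[c 0 0 - r, c 0 0 + r] `*` `[c 1 0 - r, c 1 0 + r].
Proof.
move=> r0; have p2 p (i : 'I_2) : (c - col_of_pair p) i 0 =
    c i 0 - (if i == 0 then p.1 else p.2) by rewrite !mxE.
apply/seteqP; split=> p /=; rewrite /square /= !in_itv /= -!ler_distlC.
  move=> pr; split; rewrite (le_trans _ pr)//.
    by have := mx_entry_le_norm (c - col_of_pair p) 0 0; rewrite p2.
  by have := mx_entry_le_norm (c - col_of_pair p) 1 0; rewrite p2.
move=> [p1r p2r]; apply: mx_norm_le => // i j; rewrite ord1 p2.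
by case: (ord2_cases i) => ->.
Qed.

Lemma measurable_square c r : 0 <= r -> measurable (square c r).
Proof. by move=> r0; rewrite squareE//; apply: measurableX. Qed.

Lemma lebesgue2_square c r : 0 <= r ->
  lebesgue2 R (square c r) = ((2 * r) ^+ 2)%:E.
Proof.
move=> r0; rewrite squareE//.
have side (a : R) : lebesgue_measure `[a - r, a + r]%classic = (2 * r)%:E.
  rewrite lebesgue_measure_itv /= lte_fin.
  have [ar|ar] := ltP (a - r) (a + r).
    by rewrite -EFinB; congr EFin; ring.
  by have -> : r = 0; [lra | rewrite mulr0].
by rewrite [LHS]product_measure1E// expr2 EFinM; congr (_ * _)%E; exact: side.
Qed.

Lemma lebesgue2T_gt0 : (0 < lebesgue2 R [set: R * R])%E.
Proof.
rewrite (@lt_le_trans _ _ (lebesgue2 R (square 0 1)))//.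
  by rewrite lebesgue2_square// lte_fin mulr1 exprn_gt0.
by apply: le_measure; rewrite ?inE//; exact: measurable_square.
Qed.

Lemma lebesgue2_squares_le (s : seq 'cV[R]_2) (r : R) : 0 <= r ->
  measurable (\big[setU/set0]_(c <- s) square c r) /\
  (lebesgue2 R (\big[setU/set0]_(c <- s) square c r) <=
    ((size s)%:R * (2 * r) ^+ 2)%:E)%E.
Proof.
move=> r0; elim: s => [|c s [ms IHs]].
  by rewrite big_nil measure0 mul0r; split=> //; exact: measurable0.
have mc := measurable_square c r0.
rewrite big_cons; split; first exact: measurableU.
apply: (le_trans (measureU2 (@lebesgue2 R) mc ms)) => /=.
rewrite lebesgue2_square//; move: (_ ^+ 2) IHs => a IHs.
by rewrite -nat1r mulrDl mul1r EFinD leeD2l.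
Qed.

(** The k-th union of squares has area at most 4 C (2 q ^ 2) ^ k, the term of a
    convergent geometric series. *)
Lemma limsup_squares_null (s : nat -> seq 'cV[R]_2) (C : nat) (q : R) :
  (forall k, size (s k) <= C * 2 ^ k)%N -> 0 <= q -> 2 * q ^+ 2 < 1 ->
  (@lebesgue2 R).-negligible [set p | forall K, exists2 k, (K <= k)%N &
    exists2 c, c \in s k & square c (q ^+ k) p].
Proof.
move=> sC q0 q1.
pose E k := \big[setU/set0]_(c <- s k) square c (q ^+ k).
have qk k : 0 <= q ^+ k by rewrite exprn_ge0.
have mE k : measurable (E k) by have [] := lebesgue2_squares_le (s k) (qk k).
pose z := 2 * q ^+ 2; have z0 : 0 <= z by rewrite mulr_ge0// exprn_ge0.
have muE k : (lebesgue2 R (E k) <= (geometric (C%:R * 4) z k)%:E)%E.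
  have [_ /le_trans] := lebesgue2_squares_le (s k) (qk k); apply.
  rewrite lee_fin /geometric /=.
  have -> : C%:R * 4 * z ^+ k = (C * 2 ^ k)%:R * (2 * q ^+ k) ^+ 2.
    by rewrite /z natrM natrX !exprMn; ring.
  by rewrite ler_wpM2r ?sqr_ge0// ler_nat.
have sumE : (\sum_(k <oo) lebesgue2 R (E k) < +oo)%E.
  rewrite (@le_lt_trans _ _ (C%:R * 4 / (1 - z))%:E) ?ltry//.
  apply: lime_le; first exact: is_cvg_nneseries.
  apply: nearW => n; rewrite (le_trans (lee_sum _ (fun k _ => muE k)))//.
  rewrite sumEFin lee_fin.
  have -> : \sum_(0 <= k < n) geometric (C%:R * 4) z k =
      series (geometric (C%:R * 4) z) n by [].
  rewrite geometric_seriesE ?lt_eqF//=.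
  rewrite ler_wpM2r//; first by rewrite invr_ge0 subr_ge0 ltW.
  by rewrite ler_piMr// gerBl exprn_ge0.
exists (lim_sup_set E); split.
- by apply: bigcapT_measurable => n; apply: bigcup_measurable => k _; exact: mE.
- exact: lim_sup_set_cvg0.
- move=> p /= pE K _; have [k Kk [c cs pc]] := pE K.
  by exists k => //; rewrite /E -bigcup_seq; exists c.
Qed.

End borel_cantelli_squares.

(** * The density exponent *)

Section approximation.
Context {R : realType}.

Lemma powR_oppr_le (a b mu : R) : 0 < a -> a <= b -> 0 <= mu ->
  b `^ (- mu) <= a `^ (- mu).
Proof.
move=> a0 ab mu0; have b0 := lt_le_trans a0 ab.
rewrite !powRN lef_pV2 ?posrE ?powR_gt0//.
by apply: ge0_ler_powR => //; rewrite nnegrE ltW.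
Qed.

Lemma dyadic_floor (a : R) (K : nat) : (2 ^ K)%:R <= a ->
  exists2 k, (K <= k)%N & (2 ^ k)%:R <= a <= (2 ^ k.+1)%:R.
Proof.
move=> Ka; have a0 : 0 <= a by rewrite (le_trans _ Ka).
have /andP[ta at_] := truncn_itv a0; set t := Num.truncn a in ta at_.
have Kt : (2 ^ K <= t)%N by rewrite -ltnS -(ltr_nat R) (le_lt_trans Ka).
have t0 : (0 < t)%N by rewrite (leq_trans _ Kt)// expn_gt0.
exists (trunc_log 2 t); first by rewrite trunc_log_max.
have /andP[lt tl] := trunc_log_bounds (isT : (1 < 2)%N) t0.
rewrite (le_trans _ ta) ?ler_nat//=.
by rewrite (le_trans (ltW at_))// ler_nat.
Qed.

(** A multiple of 2 ^ k bounds the number of elements of norm about 2 ^ k that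
    move x into the annulus, and each of them is responsible for a square of
    area of order 2 ^ (- 2 mu k).  The product is geometric of ratio
    2 ^ (1 - 2 mu), less than 1 as soon as mu > 1/2. *)
Lemma approximable_null (Gamma : set 'M[R]_2) (x : 'cV[R]_2) (B mu : R) :
  subgroup_SL2 Gamma -> Gamma `<=` isolated Gamma -> x != 0 -> 0 < B ->
  1 / 2 < mu ->
  (@lebesgue2 R).-negligible [set p | forall K : nat, exists gamma,
    [/\ Gamma gamma, K%:R <= `|gamma|, B^-1 <= `|gamma *m x|,
        `|gamma *m x| <= B &
        `|gamma *m x - col_of_pair p| <= `|gamma| `^ (- mu)]].
Proof.
move=> Ggrp Gisol x0 B0 mu2.
have [C count] := discrete_orbit_count Ggrp Gisol x0 B0.
have /choice[s sP] : forall k, exists s : seq 'M[R]_2,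
    (size s <= C * 2 ^ k.+1)%N /\
    forall gamma, Gamma gamma -> `|gamma| <= (2 ^ k.+1)%:R ->
      B^-1 <= `|gamma *m x| -> `|gamma *m x| <= B -> gamma \in s.
  by move=> k; have [|s ? ?] := count (2 ^ k.+1)%N; [rewrite expn_gt0|exists s].
pose q : R := 2 `^ (- mu).
have qk k : (2 ^ k)%:R `^ (- mu) = q ^+ k.
  rewrite /q -(powR_mulrn k (powR_ge0 _ _)) -powRrM mulrC powRrM.
  by rewrite powR_mulrn// natrX.
apply: (negligibleS _ (@limsup_squares_null R
  (fun k => [seq gamma *m x | gamma <- s k]) (C * 2) q _ _ _)).
- move=> p /= papp K; have [gamma [Gg Kg gB Bg gp]] := papp (2 ^ K)%N.
  have [k Kk /andP[kg gk]] := dyadic_floor Kg.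
  exists k => //; exists (gamma *m x).
    by apply: map_f; have [_] := sP k; apply.
  rewrite /square /= -qk (le_trans gp)// powR_oppr_le//; lra.
- by move=> k; rewrite size_map -mulnA -expnS; have [] := sP k.
- exact: powR_ge0.
- have -> : 2 * q ^+ 2 = 2 `^ (1 - 2 * mu).
    rewrite powRD; last by apply/implyP => _; rewrite pnatr_eq0.
    rewrite powRr1// /q; congr (_ * _).
    by rewrite -(powR_mulrn 2 (powR_ge0 _ _)) -powRrM; congr (_ `^ _); ring.
  rewrite /powR pnatr_eq0 /= expR_lt1 pmulr_llt0 ?ln_gt0 ?ltr1n//; lra.
Qed.

End approximation.

Section generic.
Context {R : realType}.

(** A single integer n controls both the annulus and the excess of the exponent
    over 1/2, which leaves only countably many exceptional sets.  Since
    gamma x tends to y along the solutions and y <> 0, the points gamma x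
    end up in an annulus around the origin that depends only on y. *)
Lemma density_exponent_gt_half (Gamma : set 'M[R]_2) (x y : 'cV[R]_2) :
  subgroup_SL2 Gamma -> Gamma `<=` isolated Gamma -> x != 0 -> y != 0 ->
  ((1 / 2)%:E < density_exponent Gamma x y)%E ->
  exists n : nat, forall K : nat, exists gamma,
    [/\ Gamma gamma, K%:R <= `|gamma|, n.+1%:R^-1 <= `|gamma *m x|,
        `|gamma *m x| <= n.+1%:R &
        `|gamma *m x - y| <= `|gamma| `^ (- (1 / 2 + n.+1%:R^-1))].
Proof.
move=> Ggrp Gisol x0 y0 /ereal_sup_gt[_ [mu /= inf_mu <-]]; rewrite lte_fin => mu2.
have ny : 0 < `|y| by rewrite normr_gt0.
pose n := Num.truncn ((mu - 1 / 2)^-1 + 2 / `|y| + 2 * `|y|).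
have dmu : 0 < (mu - 1 / 2)^-1 by rewrite invr_gt0 subr_gt0.
have y2 : 0 < 2 / `|y| by rewrite divr_gt0.
have nP : (mu - 1 / 2)^-1 + 2 / `|y| + 2 * `|y| < n.+1%:R by exact: truncnS_gt.
have n0 : 0 < n.+1%:R :> R by rewrite ltr0n.
have nmu : 1 / 2 + n.+1%:R^-1 <= mu.
  rewrite -lerBrDl -[leRHS]invrK lef_pV2 ?posrE//; lra.
have nyinv : n.+1%:R^-1 <= `|y| / 2.
  by rewrite -[leRHS]invf_div lef_pV2 ?posrE//; lra.
(* From |gamma| >= r on, |gamma| ^ (- mu) is at most |y| / 2. *)
pose r := (`|y| / 2) `^ (- mu^-1).
exists n => K.
pose L := (K + (Num.truncn r).+1)%N.
have [gamma [[Gg gy] gL]] : exists gamma,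
    [set gamma | Gamma gamma /\ `|gamma *m x - y| <= `|gamma| `^ (- mu)] gamma /\
    L%:R < `|gamma|.
  have /infinite_setN0[gamma [Sg /= NgL]] := infinite_setD inf_mu
    (discrete_finite_ball L Ggrp Gisol x0).
  exists gamma; split=> //; rewrite ltNge; apply/negP => gL; apply: NgL.
  by case: Sg.
have g1 : 1 <= `|gamma|.
  by rewrite (le_trans _ (ltW gL))// ler1n /L addnS.
have rg : r <= `|gamma|.
  rewrite (le_trans _ (ltW gL))// /L natrD (le_trans (ltW (truncnS_gt r)))//.
  by rewrite lerDr.
have mu0 : 0 < mu by lra.
have gy2 : `|gamma *m x - y| <= `|y| / 2.
  rewrite (le_trans gy)// (le_trans (powR_oppr_le _ rg (ltW mu0)))//.
    by rewrite /r powR_gt0// divr_gt0.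
  by rewrite /r -powRrM mulrNN mulVf ?gt_eqF// powRr1// divr_ge0.
exists gamma; split=> //.
- by rewrite (le_trans _ (ltW gL))// ler_nat leq_addr.
- have yg : `|y| <= `|gamma *m x| + `|gamma *m x - y|.
    by rewrite [`|_ - _|]distrC -[X in `|X| <= _](subrKC (gamma *m x)) ler_normD.
  by rewrite (le_trans nyinv)// -(lerD2r (`|y| / 2)) -splitr (le_trans yg)// lerD2l.
- have gyD : `|gamma *m x| <= `|gamma *m x - y| + `|y|.
    by rewrite -[X in `|X| <= _](subrK y) ler_normD.
  rewrite (le_trans gyD)// (le_trans (lerD gy2 (lexx _)))//; lra.
- by rewrite (le_trans gy)// ler_powR// lerN2.
Qed.

Lemma density_exponent_ae_le_half (Gamma : set 'M[R]_2) (x : 'cV[R]_2) :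
  subgroup_SL2 Gamma -> Gamma `<=` isolated Gamma -> x != 0 ->
  {ae @lebesgue2 R, forall p,
    (density_exponent Gamma x (col_of_pair p) <= (1 / 2)%:E)%E}.
Proof.
move=> Ggrp Gisol x0.
have null0 : (@lebesgue2 R).-negligible [set p : R * R | col_of_pair p = 0].
  apply: (@negligibleS _ _ _ (@lebesgue2 R) (square 0 0)).
    by move=> p /= p0; rewrite /square /= p0 subr0 normr0.
  apply/negligibleP; first exact: measurable_square.
  by rewrite [LHS]lebesgue2_square// mulr0 expr0n.
have nulln := negligible_bigcup (fun n : nat => @approximable_null R Gamma x n.+1%:R
  (1 / 2 + n.+1%:R^-1) Ggrp Gisol x0 (ltr0Sn R n) _).
apply: negligibleS (negligibleU null0 (nulln _)) => [p /= /negP|n]; last first.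
  by rewrite ltrDl invr_gt0.
rewrite -ltNge => /density_exponent_gt_half pn.
have [p0|p0] := eqVneq (col_of_pair p) 0; first by left.
by right; have [n nP] := pn Ggrp Gisol x0 p0; exists n.
Qed.

(** The orbit of the origin is the origin alone. *)
Lemma dense_orbit_neq0 (Gamma : set 'M[R]_2) (x : 'cV[R]_2) :
  dense (orbit_col Gamma x) -> x != 0.
Proof.
move=> orbit_dense; apply/eqP => x0.
have [|y [yb [gamma _ gy]]] := orbit_dense _ _ (ball_open (const_mx 1 : 'cV[R]_2) 1).
  by exists (const_mx 1); exact: ballxx.
move: yb; rewrite -gy x0 mulmx0 mx_norm_ball /ball_ /= subr0 ltNge.
by have := mx_entry_le_norm (const_mx 1 : 'cV[R]_2) 0 0; rewrite mxE normr1 => ->.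
Qed.

(** An almost everywhere constant function on a space of positive measure has that
    constant as essential supremum, so both cases of the definition agree. *)
Lemma generic_density_exponentE (Gamma : set 'M[R]_2) (x : 'cV[R]_2) :
  generic_density_exponent Gamma x =
  ess_sup (@lebesgue2 R) (fun p => density_exponent Gamma x (col_of_pair p)).
Proof.
rewrite /generic_density_exponent; case: xgetP => // c _ xc.
by apply/esym/ess_sup_ae_cst => //; exact: lebesgue2T_gt0.
Qed.

End generic.

Theorem theorem4 (R : realType) (Gamma : set 'M[R]_2)
    (Gamma_lattice : lattice_SL2 Gamma) (x : 'cV[R]_2)
    (dense_orbit : dense (orbit_col Gamma x)) :
  (generic_density_exponent Gamma x <= (1 / 2)%:E)%E.
Proof.
have [Ggrp Gisol _] := Gamma_lattice.
rewrite generic_density_exponentE; apply/ess_supP.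
exact: density_exponent_ae_le_half Ggrp Gisol (dense_orbit_neq0 dense_orbit).
Qed.
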